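(* Let $q_n\in(0,1]$, $n=1,2,\dots$, with $q_n\to0$ as $n\to\infty$, and for each $n$ consider $q_n$-proportion Bulgarian solitaire on $n$ cards. (i) If $q_n^2n\to0$, then the recurrent configurations have a triangular limit shape, namely $\phi(x)=\max(1-x/2,\,0)$. (ii) If $q_n^2n\to\infty$, then the recurrent configurations have an exponential limit shape, namely $\phi(x)=e^{-x}$.
   Context: A configuration of $n$ cards is an integer partition $\lambda=(\lambda_1\ge\lambda_2\ge\cdots\ge\lambda_\ell>0)$ of $n$, extended by $\lambda_i=0$ for $i>\ell$; $\mathcal{P}(n)$ denotes the set of these. In a move of $q$-proportion Bulgarian solitaire ($q\in(0,1]$), $\lceil qh\rceil$ cards are picked from each nonempty pile of size $h$, all picked cards together form one new pile, and the resulting piles are sorted in weakly decreasing order (empty piles being discarded). Let $f_n:\mathcal{P}(n)\to\mathcal{P}(n)$ be the map given by one move of $q_n$-proportion Bulgarian solitaire. A configuration $\lambda\in\mathcal{P}(n)$ is recurrent if $f_n^k(\lambda)=\lambda$ for some positive integer $k$. For a partition $\lambda$ of $n$, the downscaled diagram-boundary function is $\partial\lambda(x)=\frac{1}{\lambda_1}\lambda_{\lfloor xn/\lambda_1\rfloor+1}$ for $x\ge0$. A function $\phi$ is a limit shape of recurrent configurations if, for every choice of recurrent configurations $\lambda^{(n)}$ of $f_n$ ($n=1,2,\dots$), $\partial\lambda^{(n)}(x)\to\phi(x)$ as $n\to\infty$ for all $x>0$. *)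

(* Defs.v *)
(* MathComp and MathComp-Analysis; the reals are an arbitrary R : realType. *)
From mathcomp Require Import all_boot all_order all_algebra.
From mathcomp Require Import all_classical all_reals all_analysis.

Set Implicit Arguments.
Unset Strict Implicit.
Unset Printing Implicit Defensive.

Import Order.TTheory GRing.Theory Num.Theory.
Import numFieldNormedType.Exports.

Local Open Scope classical_set_scope.
Local Open Scope ring_scope.

(* A partition is the sequence of its positive parts in weakly decreasing order.
   Since [nth 0%N] has default value 0, [nth 0%N lam i] is the part
   $\lambda_{i+1}$ under the convention $\lambda_j = 0$ for $j > \ell$. *)
Definition is_partition (n : nat) (lam : seq nat) : bool :=
  [&& sorted geq lam, all (leq 1) lam & sumn lam == n].

Definition pick_size (R : realType) (q : R) (h : nat) : nat :=
  `|Num.ceil (q * h%:R)|%N.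

Definition bulgarian_move (R : realType) (q : R) (lam : seq nat) : seq nat :=
  sort geq [seq h <- sumn [seq pick_size q h | h <- lam] ::
                     [seq (h - pick_size q h)%N | h <- lam] | (0 < h)%N].

Lemma pick_size_le (R : realType) (q : R) (h : nat) :
  0 < q <= 1 -> (pick_size q h <= h)%N.
Proof.
move=> /andP[q0 q1]; rewrite /pick_size -lez_nat gez0_abs.
  by rewrite ceil_le_int ler_piMl.
by rewrite ceil_ge0 (lt_le_trans (ltrN10 R)) // mulr_ge0 // ltW.
Qed.

(* Hence [bulgarian_move q] restricts to a map from the partitions of [n] to
   themselves. *)
Lemma bulgarian_move_partition (R : realType) (q : R) (n : nat)
    (lam : seq nat) :
  0 < q <= 1 -> is_partition n lam -> is_partition n (bulgarian_move q lam).
Proof.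
move=> q01 /and3P[_ _ /eqP sum_lam]; apply/and3P; split.
- by apply: sort_sorted => a b; rewrite /geq /= leq_total.
- by rewrite all_sort; apply/allP => a; rewrite mem_filter => /andP[].
- have sumn_pos s : sumn [seq h <- s | (0 < h)%N] = sumn s.
    by elim: s => //= -[|a] s IH //=; rewrite IH.
  rewrite /bulgarian_move (perm_sumn (permEl (perm_sort _ _))) sumn_pos /=.
  rewrite -sum_lam; apply/eqP; elim: {sum_lam} lam => //= h lam IH.
  by rewrite addnACA IH subnKC // pick_size_le.
Qed.

Definition recurrent (R : realType) (q : R) (n : nat) (lam : seq nat) : Prop :=
  is_partition n lam /\
  exists k : nat, (0 < k)%N /\ iter k (bulgarian_move q) lam = lam.

(* The index is shifted by one because [nth] counts parts from 0; for $x \ge 0$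
   [Num.truncn] is the floor. *)
Definition boundary (R : realType) (n : nat) (lam : seq nat) (x : R) : R :=
  (nth 0%N lam 0)%:R^-1 *
  (nth 0%N lam (Num.truncn (x * n%:R / (nth 0%N lam 0)%:R)))%:R.

(* Configurations are indexed by $n \ge 1$; [lam 0] and [q 0] are irrelevant. *)
Definition recurrent_limit_shape (R : realType) (q : nat -> R) (phi : R -> R) :
    Prop :=
  forall lam : nat -> seq nat,
    (forall n : nat, (0 < n)%N -> recurrent (q n) n (lam n)) ->
    forall x : R, 0 < x -> boundary n (lam n) x @[n --> \oo] --> phi x.

(* Main.v *)
Require Import Defs.
From mathcomp Require Import all_boot all_order all_algebra.
From mathcomp Require Import all_classical all_reals all_analysis.
From mathcomp Require Import zify ring lra.
Import Order.TTheory GRing.Theory Num.Theory.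
Import numFieldNormedType.Exports.
Local Open Scope classical_set_scope.
Local Open Scope ring_scope.

(* Order the piles by age rather than by size.  With [g h = h - ceil (q * h)] and
   [N t] the pile created at time [t], a recurrent configuration is the multiset
   of the nonzero [g^a (N (T - 1 - a))], and everything reduces to controlling the
   sequence [N].  Every pile loses a card per move, so among [l] piles half have
   at some earlier time been about [l / 2] high; hence [l ^ 2 <= 4 n], and as
   [N t] is [q n] up to the number of piles, [q n <= N t <= q n + 2 sqrt n].

   If [q ^ 2 n] tends to infinity, then [N t ~ q n]; the pile of age [a] has
   size [(1 - q) ^ a * q n] up to lower order terms, whence the exponential.

   If [q ^ 2 n] tends to 0, then eventually [q * N t <= 1], so exactly one card is
   picked from each pile (classical Bulgarian solitaire) and [N t] counts the
   ages [a] with [a < N (t - 1 - a)].  A double counting of ages shows that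
   [i <= N t] iff [i <= N (t + i)], so that [N] takes at most two consecutive
   values; the configuration is a staircase up to one card per pile. *)

Set Implicit Arguments.
Unset Strict Implicit.

(** * Periodic sequences that count their own surviving ages *)

Section Coverage.
Local Open Scope nat_scope.

Lemma sum_periodic_shift (k : nat) (F : nat -> nat) (c : nat) :
  (forall t, F (t + k) = F t) -> \sum_(t < k) F (t + c) = \sum_(t < k) F t.
Proof.
move=> Fk; elim: c => [|c <-]; first by under eq_bigr do rewrite addn0.
apply: (@addIn (F c)).
have : \sum_(t < k.+1) F (t + c) = F (0 + c) + \sum_(t < k) F (bump 0 t + c).
  by rewrite big_ord_recl.
rewrite big_ord_recr /= (addnC k c) Fk add0n => ->.
rewrite addnC; congr (_ + _); apply: eq_bigr => i _.
by rewrite /bump /= add1n addSnnS.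
Qed.

Lemma sum_prefix (A m : nat) (F : nat -> nat) :
  m <= A -> \sum_(a < A) (a < m) * F a = \sum_(a < m) F a.
Proof.
move=> mA; rewrite (big_ord_widen A F mA) [RHS]big_mkcond /=.
by apply: eq_bigr => i _; case: ltnP; rewrite ?mul1n ?mul0n.
Qed.

(** Induction on [A]: a newly selected age [A] is at least the number [m] of ages selected before
    it, and ['C(m.+1, 2) = 'C(m, 2) + m]; equality forces [m = A], so there was no gap. *)
Lemma sum_ages_ge (p : pred nat) (A : nat) :
  'C(\sum_(a < A) p a, 2) <= \sum_(a < A) p a * a /\
  ('C(\sum_(a < A) p a, 2) = \sum_(a < A) p a * a ->
   forall a, a < A -> p a = (a < \sum_(b < A) p b)).
Proof.
elim: A => [|A [IHle IHeq]]; first by rewrite !big_ord0; split.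
have leA : \sum_(a < A) p a <= A.
  rewrite -[leqRHS]card_ord -sum1_card; apply: leq_sum => i _; exact: leq_b1.
rewrite !big_ord_recr /=; move: (\sum_(a < A) p a) leA IHle IHeq => m leA.
move: (\sum_(a < A) p a * a) => S IHle IHeq.
case pA: (p A); rewrite ?mul1n ?mul0n ?addn0; last first.
  split=> // /IHeq e a; rewrite ltnS leq_eqVlt => /predU1P[->|/e //].
  by rewrite pA ltnNge leA.
rewrite addn1 binS bin1; split=> [|e]; first exact: leq_add.
have mA : m = A by lia.
have {}e : 'C(m, 2) = S by lia.
move=> a; rewrite ltnS leq_eqVlt => /predU1P[->|aA].
  by rewrite pA mA ltnSn.
by rewrite (IHeq e a aA) mA aA ltnS ltnW.
Qed.

(* Seen from time [t], the ages [a < A] with [a < f (t.-1 - a)] are [f t] distinct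
   naturals, so their sum is at least ['C(f t, 2)].  Summed over a period, the
   ages at which the interval issued at time [s] is alive also contribute
   ['C(f s, 2)]; hence equality holds at every [t], i.e. the ages form a prefix. *)
Lemma coverage_shift (f : nat -> nat) (k A : nat) : 0 < k ->
    (forall t, f (t + k) = f t) -> (forall t, f t <= A) ->
    (forall t, A <= t -> f t = \sum_(a < A) (a < f (t.-1 - a))) ->
  forall i t, (i <= f (t + i)) = (i <= f t).
Proof.
move=> k0 fk fA fE.
have fkM j t : f (t + j * k) = f t.
  by elim: j => [|j IH]; rewrite ?mul0n ?addn0// mulSn (addnC k) addnA fk IH.
(* Level [i + 1] of the claim is [key] for age [i] at time [t + i + 1], delayed by [A] periods so
   that the time is past [A]. *)
suff key t a : A <= t -> a < A -> (a < f (t.-1 - a)) = (a < f t).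
  case=> [//|i] t; have [iA|Ai] := ltnP i A; last first.
    by rewrite !ltnNge !(leq_trans (fA _) Ai).
  have := key (t + i.+1 + A * k) i; rewrite fkM => <- //; last by nia.
  by rewrite -[in RHS](fkM A t); congr (_ < f _); lia.
move=> tA aA.
have dbl : \sum_(u < k) \sum_(b < A) (b < f ((u + t).-1 - b)) * b
         = \sum_(u < k) 'C(f (u + t), 2).
  rewrite (@sum_periodic_shift k (fun u => 'C(f u, 2))); last first.
    by move=> u; rewrite fk.
  rewrite exchange_big /=.
  under eq_bigr => b _.
    under eq_bigr => u _.
      rewrite (_ : (u + t).-1 - b = u + (t.-1 - b)); last first.
        have := ltn_ord b; lia.
      over.
    rewrite (@sum_periodic_shift k (fun u => (b < f u) * b)); last first.
      by move=> u; rewrite fk.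
    over.
  rewrite exchange_big /=; apply: eq_bigr => u _.
  by rewrite (@sum_prefix _ _ id) // -bin2_sum big_mkord.
have := @leqif_sum 'I_k xpredT
  (fun u => 'C(f (u + t), 2) == \sum_(b < A) (b < f ((u + t).-1 - b)) * b)
  (fun u => 'C(f (u + t), 2))
  (fun u => \sum_(b < A) (b < f ((u + t).-1 - b)) * b).
move=> /(_ _)[|_]; first move=> u _.
  split=> //; rewrite [in leqLHS](fE (u + t)); last by lia.
  by case: (sum_ages_ge (fun b => b < f ((u + t).-1 - b)) A).
rewrite dbl eqxx => /esym/forallP/(_ (Ordinal k0)) /= /eqP.
rewrite add0n => e; rewrite [in RHS](fE t) //.
by apply: (proj2 (sum_ages_ge (fun b => b < f (t.-1 - b)) A)); rewrite -?fE.
Qed.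

(* The level set of height [i] is [i]-periodic and the one of height [i + 1] is
   [(i + 1)]-periodic, so by the Chinese remainder theorem the latter cannot be
   nonempty and contained in the former unless the former is everything. *)
Lemma coverage_almost_constant (f : nat -> nat) :
    (forall i t, (i <= f (t + i)) = (i <= f t)) ->
  forall s t, f s <= (f t).+1.
Proof.
move=> fS s t; rewrite leqNgt; apply/negP => lt_fts.
have fM i j u : (i <= f (u + j * i)) = (i <= f u).
  by elim: j => [|j IH]; rewrite ?mul0n ?addn0// mulSn (addnC i) addnA fS IH.
(* [y] makes [s + y * (i + 1)] congruent to [t] modulo [i]: level [i + 1] is carried from [s] to
   this point, and level [i] from there back to [t], where it fails. *)
set i := (f t).+1 in lt_fts; pose y := t + i.-1 * s.
have := fM i.+1 y s; rewrite lt_fts (_ : s + y * i.+1 = t + (s + y) * i).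
  by move=> /ltnW; rewrite fM ltnn.
rewrite /y /i /=; lia.
Qed.

End Coverage.

(** * Partitions: sorted parts read off from counts, which do not see the order *)

Lemma sorted_geq_nth (s : seq nat) (c m : nat) : sorted geq s -> (0 < c)%N ->
  (c <= nth 0%N s m)%N = (m < count (leq c) s)%N.
Proof.
move=> + c0; elim: s m => [|h s IH] m; first by rewrite nth_nil leqNgt c0.
rewrite /= (path_sortedE (rev_trans leq_trans)) => /andP[/allP hs ss].
case: (leqP c h) => [ch|hc]; first by case: m => //= m; rewrite IH.
have -> : count (leq c) s = 0%N.
  apply/eqP; rewrite -leqn0 leqNgt -has_count; apply/hasPn => x /hs.
  by rewrite /geq /= -ltnNge => /leq_ltn_trans; apply.
rewrite addn0; case: m => [|m] /=; first by rewrite leqNgt hc.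
apply/negbTE; rewrite -ltnNge.
have [/(mem_nth 0%N)/hs xh|sm] := ltnP m (size s).
  exact: leq_ltn_trans hc.
by rewrite nth_default.
Qed.

Lemma mul_count_le_sumn (c : nat) (s : seq nat) :
  (c * count (leq c) s <= sumn s)%N.
Proof. by elim: s => [|h s IH] /=; [rewrite muln0|case: leqP; nia]. Qed.

Lemma partition_part_le (n : nat) (lam : seq nat) (h : nat) :
  is_partition n lam -> h \in lam -> (h <= n)%N.
Proof.
case/and3P => _ _ /eqP <-; elim: lam => //= x lam IH; rewrite inE.
by case/predU1P => [->|/IH]; lia.
Qed.

Lemma iter_periodic (T : Type) (f : T -> T) (k : nat) (x : T) :
  iter k f x = x -> forall j, iter (j * k) f x = x.
Proof.
by move=> fx; elim=> [//|j IH]; rewrite mulSn iterD IH.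
Qed.

(** * The effect of moves on a single pile and on the multiset of piles *)

Definition leftover (R : realType) (q : R) (h : nat) : nat :=
  (h - pick_size q h)%N.

Definition new_pile (R : realType) (q : R) (lam : seq nat) : nat :=
  sumn [seq pick_size q h | h <- lam].

(** This is [N t]; the pile first belongs to the configuration at time [t + 1], so the pile of age
    [a] at time [t] is number [t.-1 - a]. *)
Definition pile_at (R : realType) (q : R) (lam : seq nat) (t : nat) : nat :=
  new_pile q (iter t (bulgarian_move q) lam).

Lemma pick_size_bounds (R : realType) (q : R) (h : nat) : 0 < q ->
  q * h%:R <= (pick_size q h)%:R < q * h%:R + 1.
Proof.
move=> q0; rewrite /pick_size natr_absz ger0_norm; last first.
  by rewrite ceil_ge0 (lt_le_trans (ltrN10 R)) // mulr_ge0 // ltW.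
by rewrite ceil_ge /= -ltrBlDr -[1]/(1%:~R) -intrB ceilB1_lt.
Qed.

Lemma pick_size_gt0 (R : realType) (q : R) (h : nat) : 0 < q -> (0 < h)%N ->
  (0 < pick_size q h)%N.
Proof.
move=> q0 h0; have /andP[+ _] := pick_size_bounds h q0.
by rewrite -(ltr_nat R); apply: lt_le_trans; rewrite mulr_gt0 // ltr0n.
Qed.

Lemma leftover_le (R : realType) (q : R) (h : nat) : 0 < q ->
  (leftover q h <= h.-1)%N.
Proof.
move=> q0; rewrite /leftover; case: h => [//|h].
by have := pick_size_gt0 q0 (ltn0Sn h); lia.
Qed.

Lemma iter_leftover_le (R : realType) (q : R) (a h : nat) : 0 < q ->
  (iter a (leftover q) h <= h - a)%N.
Proof.
move=> q0; elim: a => [|a IH] /=; first by rewrite subn0.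
by have := leftover_le (iter a (leftover q) h) q0; lia.
Qed.

Lemma leftover_bounds (R : realType) (q : R) (h : nat) : 0 < q <= 1 ->
  (1 - q) * h%:R - 1 <= (leftover q h)%:R <= (1 - q) * h%:R.
Proof.
move=> q01; have /andP[q0 _] := q01; have := pick_size_bounds h q0.
by rewrite /leftover natrB ?pick_size_le // => /andP[? ?]; lra.
Qed.

(** Each move rounds away at most one card, and earlier losses shrink by the factor [1 - q], so the
    total loss is below the geometric sum [q^-1]. *)
Lemma iter_leftover_bounds (R : realType) (q : R) (a h : nat) : 0 < q <= 1 ->
  (1 - q) ^+ a * h%:R - q^-1 <= (iter a (leftover q) h)%:R
    <= (1 - q) ^+ a * h%:R.
Proof.
move=> q01; have /andP[q0 q1] := q01.
have qV : q * q^-1 = 1 by rewrite mulfV // gt_eqF.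
have qV0 : 0 < q^-1 by rewrite invr_gt0.
elim: a => [|a /andP[IHl IHr]] /=.
  by rewrite expr0 mul1r lexx gerBl ltW.
have /andP[gl gr] := leftover_bounds (iter a (leftover q) h) q01.
rewrite !exprS -!mulrA; apply/andP; split.
  apply: le_trans gl; rewrite lerBrDr.
  have := ler_wpM2l (_ : 0 <= 1 - q) IHl; rewrite subr_ge0 => /(_ q1).
  by move: ((1 - q) ^+ a * h%:R) => x; lra.
by apply: le_trans gr _; rewrite ler_wpM2l // subr_ge0.
Qed.

(** A predicate that fails at 0 does not notice that empty piles are discarded. *)
Lemma count_move (R : realType) (q : R) (p : pred nat) (lam : seq nat) :
  ~~ p 0%N ->
  count p (bulgarian_move q lam) =
  (p (new_pile q lam) + count (p \o leftover q) lam)%N.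
Proof.
move=> /negbTE p0; rewrite /bulgarian_move.
rewrite (permP (permEl (perm_sort _ _))) count_filter.
have /eq_count -> : predI p [eta leq 1] =1 p.
  by move=> [|h] /=; rewrite ?p0 ?andbF ?andbT.
by rewrite /= count_map.
Qed.

(* The pile created [a] moves before the last one has [a] moves of depletion. *)
Lemma count_iter_move (R : realType) (q : R) (lam : seq nat) (t : nat)
    (p : pred nat) : 0 < q -> ~~ p 0%N ->
  count p (iter t (bulgarian_move q) lam) =
  (count (fun a => p (iter a (leftover q) (pile_at q lam (t.-1 - a))))
     (iota 0 t) + count (p \o iter t (leftover q)) lam)%N.
Proof.
move=> q0; elim: t p => [|t IH] p p0 //=.
rewrite count_move // IH /=; last first.
  by have := leftover_le 0 q0; rewrite leqn0 => /eqP ->.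
rewrite addnA subn0; congr (_ + _ + _)%N.
rewrite (iotaDl 1 0 t) count_map; apply: eq_count => a /=.
by congr (p (leftover q (iter a _ (pile_at q lam _)))); lia.
Qed.

(** * Recurrent configurations: number of piles, size of new piles, bounds on parts *)

Lemma recurrent_predecessor {R : realType} {q : R} {n : nat} {lam : seq nat} :
  0 < q <= 1 -> recurrent q n lam ->
  forall u t, exists2 l, is_partition n l &
    iter t (bulgarian_move q) l = iter u (bulgarian_move q) lam.
Proof.
move=> q01 [lamP [k [k0 klam]]] u t.
have iterP s : is_partition n (iter s (bulgarian_move q) lam).
  by elim: s => //= s; apply: bulgarian_move_partition.
(* On a cycle, going back [t] moves amounts to going forward [t * k - t] moves. *)
exists (iter (u + (t * k - t)) (bulgarian_move q) lam) => //.
by rewrite -iterD addnCA subnKC ?leq_pmulr // iterD iter_periodic.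
Qed.

Lemma recurrent_size {R : realType} {q : R} {n : nat} {lam : seq nat} :
  0 < q <= 1 -> recurrent q n lam -> forall u,
  (size (iter u (bulgarian_move q) lam) ^ 2 <= 4 * n)%N.
Proof.
move=> q01 lamR u; have /andP[q0 _] := q01; set l := iter u _ _.
have [l1 l1P l1E] := recurrent_predecessor q01 lamR u (size l)./2.
have lP : all (leq 1) l.
  have [l2 /and3P[_ l2P _]] := recurrent_predecessor q01 lamR u 0.
  by rewrite /l => <-.
(* At most one pile per move is new since [l1]; every older pile has lost [(size l)./2] cards and is
   still nonempty. *)
have : (size l <= (size l)./2 + count (leq (size l)./2.+1) l1)%N.
  rewrite -{1}(count_predT l) -(eq_in_count (a1 := leq 1)); last first.
    by move=> x /(allP lP).
  rewrite {1}/l -l1E count_iter_move // leq_add //.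
    by rewrite (leq_trans (count_size _ _)) // size_iota.
  apply: sub_count => h /=; have := iter_leftover_le (size l)./2 h q0; lia.
have := mul_count_le_sumn (size l)./2.+1 l1.
by case/and3P: l1P => _ _ /eqP ->; nia.
Qed.

Lemma pile_at_bounds {R : realType} {q : R} {n : nat} {lam : seq nat} :
  0 < q <= 1 -> recurrent q n lam -> forall t,
  q * n%:R <= (pile_at q lam t)%:R <= q * n%:R + 2 * Num.sqrt (n%:R : R).
Proof.
move=> q01 lamR t; have /andP[q0 _] := q01.
have sizeR := recurrent_size q01 lamR t.
have [l0 /and3P[_ _ /eqP +] /= l0E] := recurrent_predecessor q01 lamR t 0.
rewrite l0E /pile_at /new_pile.
set l := iter t _ _ in sizeR * => ln.
have /andP[pl pr] : q * (sumn l)%:R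
    <= (sumn [seq pick_size q h | h <- l])%:R
    <= q * (sumn l)%:R + (size l)%:R.
  elim: (l) => [|h s /andP[IHl IHr]] /=; first by rewrite !mulr0 addr0 lexx.
  have /andP[hl hr] := pick_size_bounds h q0.
  by rewrite !natrD -natr1; apply/andP; split; nra.
rewrite -ln pl /=; apply: le_trans pr _; rewrite lerD2l.
rewrite -(@ler_pXn2r _ 2) ?nnegrE ?mulr_ge0 ?sqrtr_ge0 //.
by rewrite exprMn sqr_sqrtr // -!natrX -natrM ler_nat ln.
Qed.

Lemma recurrent_return {R : realType} {q : R} {n : nat} {lam : seq nat} :
  recurrent q n lam -> forall m, exists2 t, (m <= t)%N &
    iter t (bulgarian_move q) lam = lam.
Proof.
move=> [_ [k [k0 klam]]] m; exists (m * k)%N; first exact: leq_pmulr.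
exact: iter_periodic.
Qed.

(** If the [m + 1] youngest piles all exceeded part [m], more than [m] parts would exceed it. *)
Lemma recurrent_part_ge {R : realType} {q : R} {n : nat} {lam : seq nat} :
  0 < q -> recurrent q n lam -> forall m, exists a t, (a <= m)%N /\
    (iter a (leftover q) (pile_at q lam t) <= nth 0%N lam m)%N.
Proof.
move=> q0 lamR m; have [/and3P[lamS _ _] _] := lamR.
have [t mt tlam] := recurrent_return lamR m.+1; set v := nth 0%N lam m.
have := sorted_geq_nth m lamS (ltn0Sn v); rewrite ltnn => /esym/negbT.
rewrite -leqNgt -{1}tlam count_iter_move // -(subnKC mt) iotaD count_cat.
set P := fun a => _; rewrite add0n => cnt.
have /allPn[a aI Pa] : ~~ all P (iota 0 m.+1).
  by apply/negP; rewrite all_count size_iota => /eqP; lia.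
exists a, ((m.+1 + (t - m.+1)).-1 - a)%N; split.
  by move: aI; rewrite mem_iota.
by move: Pa; rewrite /P -leqNgt.
Qed.

(** More than [m] parts are at least part [m], and at most [m] of them are younger than [m]. *)
Lemma recurrent_part_le {R : realType} {q : R} {n : nat} {lam : seq nat} :
  0 < q -> recurrent q n lam -> forall m, exists a t, (m <= a)%N /\
    (nth 0%N lam m <= iter a (leftover q) (pile_at q lam t))%N.
Proof.
move=> q0 lamR m; have [lamP _] := lamR; have /and3P[lamS _ _] := lamP.
have [v0|v0] := posnP (nth 0%N lam m); first by exists m, 0%N; rewrite v0.
(* After [n] moves or more the initial piles are exhausted, so only created piles are counted. *)
have [t mt tlam] := recurrent_return lamR (m + n).
have := sorted_geq_nth m lamS v0; rewrite leqnn => /esym.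
rewrite -{2}tlam count_iter_move //; last by rewrite -ltnNge.
set v := nth 0%N lam m in v0 *.
set P := fun a => _.
have -> : count (leq v \o iter t (leftover q)) lam = 0%N.
  apply/eqP; rewrite -leqn0 leqNgt -has_count; apply/hasPn => h hlam /=.
  have hn := partition_part_le lamP hlam.
  rewrite -ltnNge (leq_ltn_trans (iter_leftover_le t h q0)) //.
  suff /eqP -> : (h - t == 0)%N by [].
  by rewrite subn_eq0 (leq_trans hn) // (leq_trans (leq_addl m n)).
rewrite addn0 -(subnKC (leq_trans (leq_addr n m) mt)) iotaD count_cat => cnt.

have /hasP[a aI Pa] : has P (iota m (t - m)).
  rewrite has_count -(ltn_add2l m) addn0 (leq_trans cnt) //.
  by rewrite leq_add2r -[leqRHS](size_iota 0) count_size.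
exists a; eexists; split; last exact: Pa.
by move: aI; rewrite mem_iota => /andP[].
Qed.

Lemma count_iota_sum (p : pred nat) (A : nat) :
  count p (iota 0 A) = (\sum_(a < A) p a)%N.
Proof.
elim: A => [|A IH]; first by rewrite big_ord0.
by rewrite -addn1 iotaD count_cat IH addn1 big_ord_recr /= addn0.
Qed.

Lemma double_sum_sub (c B : nat) : (c <= B)%N ->
  ((\sum_(m < B) (c - m)) * 2 = c * c.+1)%N.
Proof.
elim: c B => [|c IH] [|B] //= cB; first by rewrite big_ord0.
  by rewrite big1.
rewrite big_ord_recl mulnDl; under eq_bigr do rewrite /= subSS.
by rewrite IH // subn0; nia.
Qed.

Lemma sumn_nth (s : seq nat) (B : nat) : (size s <= B)%N ->
  sumn s = (\sum_(m < B) nth 0 s m)%N.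
Proof.
elim: s B => [|h s IH] [|B] //= sB.
- by rewrite big_ord0.
- by rewrite big1 // => m _; rewrite nth_nil.
- by rewrite big_ord_recl (IH B).
Qed.

Lemma recurrent_iter (R : realType) (q : R) (n : nat) (lam : seq nat) :
  0 < q <= 1 -> recurrent q n lam ->
  forall u, recurrent q n (iter u (bulgarian_move q) lam).
Proof.
move=> q01 [lamP [k [k0 klam]]] u; split; last first.
  by exists k; rewrite -iterD addnC iterD klam.
by elim: u => //= u; apply: bulgarian_move_partition.
Qed.

(** * Triangular regime: one card leaves each pile *)

Section SmallPiles.
Context {R : realType} {q : R} {n : nat} {lam : seq nat}.
Hypothesis q01 : 0 < q <= 1.
Hypothesis lamR : recurrent q n lam.
Hypothesis small : forall t, q * (pile_at q lam t)%:R <= 1.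

Let q0 : 0 < q. Proof. by case/andP: q01. Qed.

Lemma pick_size_small (h : nat) : q * h%:R <= 1 -> pick_size q h = (0 < h)%N.
Proof.
move=> qh; have /andP[_] := pick_size_bounds h q0.
case: h qh => [|h] qh /=.
  by rewrite mulr0 add0r -[1]/(1%:R) ltr_nat; case: pick_size.
move=> lt2; have := pick_size_gt0 q0 (ltn0Sn h).
have : ((pick_size q h.+1)%:R < 2%:R :> R) by lra.
by rewrite ltr_nat; case: pick_size => [|[]].
Qed.

Lemma iter_leftover_small (a h : nat) : q * h%:R <= 1 ->
  iter a (leftover q) h = (h - a)%N.
Proof.
move=> qh; elim: a => [|a IH] /=; first by rewrite subn0.
rewrite IH /leftover pick_size_small; first lia.
by apply: le_trans qh; rewrite ler_pM2l // ler_nat leq_subr.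
Qed.

Lemma pile_at_size t : pile_at q lam t = size (iter t (bulgarian_move q) lam).
Proof.
rewrite /pile_at; set l := iter t _ _.
have lR : recurrent q n l := recurrent_iter q01 lamR t.
have [/and3P[_ lP _] _] := lR.
have lq h : h \in l -> q * h%:R <= 1.
  (* Every part is what remains of some created pile, so [small] bounds it. *)
  move=> hl; have [a [s [_]]] := recurrent_part_le q0 lR (index h l).
  rewrite nth_index // => le; apply: le_trans (small (s + t)).
  rewrite ler_pM2l // ler_nat /pile_at iterD.
  apply: leq_trans le _.
  exact: leq_trans (iter_leftover_le _ _ q0) (leq_subr _ _).
rewrite /new_pile; elim: (l) lP lq => //= h s IH /andP[h0 sP] sq.
rewrite IH //; last by move=> x xs; rewrite sq // inE xs orbT.
by rewrite pick_size_small ?h0 // sq // mem_head.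
Qed.

Lemma pile_at_almost_constant s t : (pile_at q lam s <= (pile_at q lam t).+1)%N.
Proof.
have [lamP [k [k0 klam]]] := lamR.
apply: coverage_almost_constant.
(* [4 * n] bounds every [N t], being a bound for its square; hence it also bounds the age of any
   surviving pile. *)
apply: (@coverage_shift _ k (4 * n)) => // [u|u|u un].
- by rewrite /pile_at iterD klam.
- rewrite pile_at_size; apply: leq_trans (recurrent_size q01 lamR u).
  by rewrite -mulnn; case: size => // x; rewrite leq_pmull.
have [/and3P[_ lP _] _] := recurrent_iter q01 lamR u.
rewrite -(count_iota_sum (fun a => a < pile_at q lam (u.-1 - a))%N).
rewrite pile_at_size.
rewrite -[LHS](count_predT) -(eq_in_count (a1 := leq 1)); last first.
  by move=> x /(allP lP).
rewrite count_iter_move // [X in (_ + X)%N](_ : _ = 0%N); last first.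
  apply/eqP; rewrite -leqn0 leqNgt -has_count; apply/hasPn => h hlam /=.
  have hn := partition_part_le lamP hlam.
  rewrite -ltnNge ltnS (leq_trans (iter_leftover_le u h q0)) // leqn0 subn_eq0.
  by rewrite (leq_trans hn) // (leq_trans _ un) // leq_pmull.
rewrite addn0 -{2}(subnKC un) iotaD count_cat.
rewrite [X in (_ + X)%N](_ : _ = 0%N) ?addn0.
  by apply: eq_count => a; rewrite iter_leftover_small // subn_gt0.
apply/eqP; rewrite -leqn0 leqNgt -has_count; apply/hasPn => a.
rewrite mem_iota add0n => /andP[na _].
rewrite iter_leftover_small // subn_gt0 -leqNgt (leq_trans _ na) //.
rewrite pile_at_size; apply: leq_trans (recurrent_size q01 lamR (u.-1 - a)).
by rewrite -mulnn; case: size => // x; rewrite leq_pmull.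
Qed.

(** Part [m] is at least some [N t - a] with [a <= m], while the largest part is at most some
    [N s <= N t + 1]. *)
Lemma staircase_part_ge m : (nth 0 lam 0 <= nth 0 lam m + m.+1)%N.
Proof.
have [a [t [am]]] := recurrent_part_ge q0 lamR m.
have [b [s [_]]] := recurrent_part_le q0 lamR 0.
by rewrite !iter_leftover_small //; have := pile_at_almost_constant s t; lia.
Qed.

Lemma staircase_part_le m : (nth 0 lam m <= (nth 0 lam 0).+1 - m)%N.
Proof.
have [a [t [am]]] := recurrent_part_le q0 lamR m.
have [b [s []]] := recurrent_part_ge q0 lamR 0.
rewrite leqn0 => /eqP -> /=.
by rewrite !iter_leftover_small //; have := pile_at_almost_constant t s; lia.
Qed.

(** The parts lie between the staircases starting at [L - 1] and at [L + 1]; truncated subtraction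
    and the default 0 allow one common summation range. *)
Lemma staircase_sum_bounds (L := nth 0%N lam 0) :
  (L.-1 * L <= n * 2 <= L.+1 * L.+2)%N.
Proof.
have [/and3P[_ _ /eqP <-] _] := lamR.
rewrite (@sumn_nth lam (size lam + L.+1)) ?leq_addr //.
have le1 : (L.-1 <= size lam + L.+1)%N by lia.
have le2 : (L.+1 <= size lam + L.+1)%N by lia.
have := double_sum_sub le1; have := double_sum_sub le2.
move: (size lam + _)%N => B {le1 le2}.
have : (\sum_(m < B) (L.-1 - m) <= \sum_(m < B) nth 0 lam m)%N.
  by apply: leq_sum => m _; have := staircase_part_ge m; rewrite -/L; lia.
have : (\sum_(m < B) nth 0 lam m <= \sum_(m < B) (L.+1 - m))%N.
  by apply: leq_sum => m _; exact: staircase_part_le.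
move=> leY leX YE XE; apply/andP; split.
  apply: leq_trans (leq_mul leX (leqnn 2)); rewrite XE.
  by case: (L) => // c; rewrite mulnC.
by rewrite -YE leq_mul.
Qed.

(** All errors are expressed through [k], which the second bound forces to 0 as [n] grows. *)
Lemma triangular_boundary_bounds (x : R) (k := (nth 0%N lam 0)%:R^-1 : R) :
  (0 < n)%N -> 0 < x ->
  [/\ 0 <= k, k ^+ 2 <= 3 * n%:R^-1,
   Num.max (1 - k - x * ((1 + k) * (1 + 2 * k) / 2)) 0 <= boundary n lam x &
   boundary n lam x <= Num.max (1 + 2 * k - x * ((1 - k) / 2)) 0].
Proof.
move=> n0 x0; have := staircase_sum_bounds; rewrite /boundary.
have : (0 < nth 0%N lam 0)%N.
  have [/and3P[_ lP /eqP ln] _] := lamR.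
  by case: (lam) lP ln => [|h s] /=; [move=> _ nE; rewrite -nE in n0|case/andP].
rewrite {}/k; set m := Num.truncn _.
have := staircase_part_ge m; have := staircase_part_le m.
have : m%:R <= x * n%:R / (nth 0%N lam 0)%:R < m.+1%:R.
  by apply: truncn_itv; rewrite divr_ge0 // mulr_ge0 // ltW.
move: (nth 0%N lam m) (nth 0%N lam 0) => v L mx vle vge L0 /andP[nge nle].
have {}vle : (v = 0)%N \/ (v + m <= L.+1)%N by lia.
have n0R : 0 < n%:R :> R by rewrite ltr0n.
have L0R : 0 < L%:R :> R by rewrite ltr0n.
have L1R : 1 <= L%:R :> R by rewrite (ler_nat R 1).
have {}nge : (L%:R - 1) * L%:R <= n%:R * 2 :> R.
  have : ((L * L)%:R <= (n * 2 + L)%:R :> R) by rewrite ler_nat; nia.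
  by rewrite natrD !natrM; lra.
have {}nle : n%:R * 2 <= (L%:R + 1) * (L%:R + 2) :> R.
  have : ((n * 2)%:R <= (L.+1 * L.+2)%:R :> R) by rewrite ler_nat.
  by rewrite !natrM -!natr1 => ?; lra.
have {}vge : L%:R <= v%:R + (m%:R + 1) :> R by rewrite natr1 -natrD ler_nat.
have kL : L%:R * L%:R^-1 = 1 :> R by rewrite mulfV // gt_eqF.
have k0 : 0 < L%:R^-1 :> R by rewrite invr_gt0.
(* [w] is [n / L^2], close to 1/2 by the staircase sums; the rescaled index [k * m] is within [k] of
   [x * w]. *)
set k := L%:R^-1 in mx kL k0 *; set w := n%:R * k ^+ 2.
have kmx : k * m%:R <= x * w /\ x * w <= k * m%:R + k.
  case/andP: mx; rewrite -natr1 => /(ler_wpM2l (ltW k0)) + /ltW.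
  move=> + /(ler_wpM2l (ltW k0)).
  by rewrite (_ : k * (x * n%:R * k) = x * w) /w; [lra|ring].
have wge : (1 - k) / 2 <= w.
  have := ler_wpM2r (ltW k0) (ler_wpM2r (ltW k0) nge).
  rewrite (_ : (L%:R - 1) * L%:R * k * k = 1 - k); last first.
    by rewrite -!mulrA (mulrA L%:R) kL mul1r mulrBl kL mul1r.
  by rewrite /w; lra.
have wle : w <= (1 + k) * (1 + 2 * k) / 2.
  have := ler_wpM2r (ltW k0) (ler_wpM2r (ltW k0) nle).
  rewrite (_ : (L%:R + 1) * (L%:R + 2) * k * k = (1 + k) * (1 + 2 * k)).
    by rewrite /w; lra.
  rewrite (_ : _ * k * k = ((L%:R + 1) * k) * ((L%:R + 2) * k)); last by ring.
  by rewrite !mulrDl kL mul1r.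
have xwge := ler_wpM2l (ltW x0) wge; have xwle := ler_wpM2l (ltW x0) wle.
case: kmx => kmx1 kmx2; split; first exact: ltW.
- rewrite ler_pdivlMr // mulrC -/w.
  have : k <= 1 by rewrite invf_le1.
  move=> k1; have := ler_piMl (ltW k0) k1.
  by move=> kk; apply: le_trans wle _; lra.
- rewrite ge_max mulr_ge0 ?ler0n ?(ltW k0) // andbT.
  by have := ler_wpM2l (ltW k0) vge; rewrite (mulrC k L%:R) kL !mulrDr; lra.
rewrite le_max; case: vle => [->|]; first by rewrite mulr0 lexx orbT.
rewrite -(ler_nat R) natrD -natr1 => vle.
have := ler_wpM2l (ltW k0) vle; rewrite !mulrDr (mulrC k L%:R) kL mulr1.
by move=> ?; apply/orP; left; lra.
Qed.

End SmallPiles.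

(** * Exponential regime: geometric depletion of piles *)

Lemma onem_expr_le_expR (R : realType) (q : R) (m : nat) : q <= 1 ->
  (1 - q) ^+ m <= expR (- (q * m%:R)).
Proof.
move=> q1; rewrite -mulNr expRM_natr lerXn2r ?nnegrE ?subr_ge0 ?expR_ge0 //.
exact: expR_ge1Dx.
Qed.

(** Uses [1 + z <= expR z] at [z = q / (1 - q)], where [1 + z] is the inverse of [1 - q]. *)
Lemma onem_expr_ge_expR (R : realType) (q : R) (m : nat) : q < 1 ->
  expR (- (q * m%:R / (1 - q))) <= (1 - q) ^+ m.
Proof.
move=> q1; have q'0 : 0 < 1 - q by rewrite subr_gt0.
rewrite mulrAC -mulNr expRM_natr.
rewrite lerXn2r ?nnegrE ?subr_ge0 ?expR_ge0 ?(ltW q1) //.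
rewrite expRN invf_ple ?posrE ?expR_gt0 //.
apply: le_trans (expR_ge1Dx _); rewrite le_eqVlt; apply/orP; left; apply/eqP.
by field; rewrite gt_eqF.
Qed.

(** Relative to [q * n], the error [d] is the spread [2 sqrt n] of the new piles and [e] is the
    rounding loss [q^-1]. *)
Lemma exponential_boundary_bounds (R : realType) (q : R) (n : nat)
    (lam : seq nat) (x : R) (e := (q ^+ 2 * n%:R)^-1)
    (d := 2 * Num.sqrt e) :
  0 < q < 1 -> recurrent q n lam -> (0 < n)%N -> 0 < x ->
  expR (- (x / (1 - q))) / (1 + d) - e <= boundary n lam x
    <= expR (q - x / (1 + d)) * (1 + d).
Proof.
move=> /andP[q0 q1] lamR n0 x0; rewrite /boundary.
have q01 : 0 < q <= 1 by rewrite q0 ltW.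
have n0R : 0 < n%:R :> R by rewrite ltr0n.
set L := nth 0%N lam 0; set m := Num.truncn _; pose v := nth 0%N lam m.
rewrite -/v; pose y := q * n%:R.
have y0 : 0 < y by rewrite mulr_gt0.
have qqn0 : 0 < q ^+ 2 * n%:R by rewrite mulr_gt0 // exprn_gt0.
have e0 : 0 < e by rewrite invr_gt0.
have d0 : 0 < d by rewrite mulr_gt0 // sqrtr_gt0.
have d10 : 0 < 1 + d by rewrite addr_gt0.
have yd : 2 * Num.sqrt (n%:R : R) = y * d.
  rewrite /d /e (sqrtrV (ltW qqn0)) sqrtrM ?sqr_ge0 //.
  rewrite sqrtr_sqr gtr0_norm // /y -{2}(sqr_sqrtr (ltW n0R)).
  by field; rewrite !gt_eqF ?sqrtr_gt0.
have ye : q^-1 = y * e.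
  by rewrite /y /e; field; rewrite !gt_eqF.
have pileR t : y <= (pile_at q lam t)%:R <= y * (1 + d).
  by rewrite mulrDr mulr1 -yd; exact: pile_at_bounds.
have q'0 : 0 <= 1 - q by rewrite subr_ge0 ltW.
have q'1 : 1 - q <= 1 by rewrite gerBl ltW.
have partR k : (1 - q) ^+ k * y - q^-1 <= (nth 0%N lam k)%:R
    <= (1 - q) ^+ k * (y * (1 + d)).
  apply/andP; split.
    have [a [t [ak]]] := recurrent_part_ge q0 lamR k.
    rewrite -(ler_nat R); apply: le_trans.
    have /andP[+ _] := iter_leftover_bounds a (pile_at q lam t) q01.
    apply: le_trans; rewrite lerB // ler_pM ?exprn_ge0 ?(ltW y0) //.
      by rewrite ler_wiXn2l.
    by have /andP[] := pileR t.
  have [a [t [ak]]] := recurrent_part_le q0 lamR k.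
  rewrite -(ler_nat R) => /le_trans; apply.
  have /andP[_ +] := iter_leftover_bounds a (pile_at q lam t) q01.
  move=> /le_trans; apply; rewrite ler_pM ?exprn_ge0 ?ler0n //.
    by rewrite ler_wiXn2l.
  by have /andP[] := pileR t.
have /andP[Ly Lyd] : y <= L%:R <= y * (1 + d).
  apply/andP; split; last by have /andP[_] := partR 0; rewrite expr0 mul1r.
  (* Age 0 means no depletion yet, so this lower bound avoids the loss [q^-1] in [partR]. *)
  have [a [t []]] := recurrent_part_ge q0 lamR 0.
  rewrite leqn0 => /eqP -> /=; rewrite -(ler_nat R); apply: le_trans.
  by have /andP[] := pileR t.
have L0 : 0 < L%:R :> R by apply: lt_le_trans Ly.
have /andP[mlo mhi] : m%:R <= x * n%:R / L%:R < m.+1%:R.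
  by apply: truncn_itv; rewrite divr_ge0 // mulr_ge0 // ltW.
(* Up to flooring, [q * m] is [x * y / L], and [L] lies between [y] and [y * (1 + d)]. *)
have qmhi : q * m%:R <= x.
  have : q * m%:R <= q * (x * n%:R / L%:R) by rewrite ler_pM2l.
  move/le_trans; apply; rewrite !mulrA ler_pdivrMr //.
  by rewrite -mulrA mulrCA ler_pM2l.
have qmlo : x / (1 + d) - q <= q * m%:R.
  have : q * (x * n%:R / L%:R) <= q * m.+1%:R by rewrite ler_pM2l // ltW.
  rewrite -natr1 mulrDr mulr1 -lerBlDr; apply: le_trans; rewrite lerB //.
  rewrite ler_pdivrMr // !mulrA mulrAC ler_pdivlMr //.
  by rewrite (_ : _ * (1 + d) = x * (y * (1 + d))) ?ler_pM2l // /y; ring.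
have /andP[vlo vhi] := partR m; rewrite -/v in vlo vhi.
have yL1 : y / L%:R <= 1 by rewrite ler_pdivrMr ?mul1r.
have yL2 : (1 + d)^-1 <= y / L%:R.
  by rewrite ler_pdivlMr // ler_pdivrMl // mulrC.
apply/andP; split.
  rewrite [leRHS]mulrC ler_pdivlMr //; apply: le_trans vlo.
  rewrite ye mulrBl lerB //.
    apply: (@le_trans _ _ ((1 - q) ^+ m * (L%:R / (1 + d)))).
      rewrite mulrAC -mulrA ler_wpM2r ?divr_ge0 ?(ltW d10) //.
      apply: le_trans (onem_expr_ge_expR _ q1); rewrite ler_expR lerN2.
      by rewrite ler_wpM2r ?invr_ge0.
    by rewrite ler_wpM2l ?exprn_ge0 // ler_pdivrMr.
  by rewrite mulrC ler_wpM2l // ltW.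
rewrite [leLHS]mulrC ler_pdivrMr //; apply: le_trans vhi _.
apply: (@le_trans _ _ ((1 - q) ^+ m * (L%:R * (1 + d)))).
  by rewrite ler_wpM2l ?exprn_ge0 // ler_pM2r.
rewrite -mulrA (mulrC (1 + d)) ler_wpM2r ?mulr_ge0 ?(ltW d10) //.
apply: le_trans (onem_expr_le_expR _ (ltW q1)) _.
by rewrite ler_expR; lra.
Qed.

(** * Passage to the limit by squeezing *)

Section Limits.
Context {R : realType} {q : nat -> R}.
Hypothesis q01 : forall n : nat, (0 < n)%N -> 0 < q n <= 1.

Lemma triangular_limit_shape :
  q n @[n --> \oo] --> (0 : R) -> q n ^+ 2 * n%:R @[n --> \oo] --> (0 : R) ->
  recurrent_limit_shape q (fun x : R => Num.max (1 - x / 2) 0).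
Proof.
move=> q_to0 y_to0 lam lamR x x0.
have small : \forall n \near \oo,
    forall t, q n * (pile_at (q n) (lam n) t)%:R <= 1.
  (* This is [q n] times the upper bound [q n + 2 sqrt n] for new piles, with [q] taken at index
     [n]. *)
  have s_to0 : q n ^+ 2 * n%:R + 2 * Num.sqrt (q n ^+ 2 * n%:R)
      @[n --> \oo] --> (0 : R).
    rewrite (_ : 0 = 0 + 2 * Num.sqrt 0 :> R); last first.
      by rewrite sqrtr0 mulr0 addr0.
    apply: cvgD => //; apply: cvgMr.
    by apply: continuous_cvg y_to0; exact: sqrt_continuous.
  apply: filterS2 _ (nbhs_infty_gt 0) (cvgr_lt _ s_to0 _ ltr01) => n n0 s1 t.
  have /andP[q0 q1] := q01 n0.
  have /andP[_] := pile_at_bounds (q01 n0) (lamR n n0) t.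
  move=> /(ler_wpM2l (ltW q0)) /le_trans; apply; apply: le_trans (ltW s1).
  rewrite sqrtrM ?sqr_ge0 // sqrtr_sqr gtr0_norm // le_eqVlt; apply/orP; left.
  by apply/eqP; ring.
pose k n := (nth 0%N (lam n) 0)%:R^-1 : R.
have bounds : \forall n \near \oo, [/\ 0 <= k n, k n ^+ 2 <= 3 * n%:R^-1,
   Num.max (1 - k n - x * ((1 + k n) * (1 + 2 * k n) / 2)) 0
     <= boundary n (lam n) x &
   boundary n (lam n) x <= Num.max (1 + 2 * k n - x * ((1 - k n) / 2)) 0].
  apply: filterS2 _ (nbhs_infty_gt 0) small => n n0 sm.
  by have := triangular_boundary_bounds (q01 n0) (lamR n n0) sm n0 x0.
have k_to0 : k n @[n --> \oo] --> (0 : R).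
  apply: (squeeze_cvgr (f := cst 0) (h := fun n => Num.sqrt (3 * n%:R^-1))).
  - apply: filterS _ bounds => n [k0 k2 _ _]; rewrite /cst k0 /=.
    by rewrite -(ger0_norm k0) -sqrtr_sqr ler_wsqrtr.
  - exact: cvg_cst.
  rewrite -[X in _ --> X](@sqrtr0 R) -(mulr0 3).
  apply: continuous_cvg; first exact: sqrt_continuous.
  apply: cvgMr; apply/gtr0_cvgV0; last exact: cvgr_idn.
  by apply: filterS _ (nbhs_infty_gt 0) => n; rewrite ltr0n.
have max_cvg (u : nat -> R) (a : R) : u n @[n --> \oo] --> a ->
    Num.max (u n) 0 @[n --> \oo] --> Num.max a 0.
  apply: (@continuous_cvg _ R R _ _ u (fun z : R => Num.max z 0)).
  apply: (@continuous_max R R id (cst 0)); first exact: cvg_id.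
  exact: cvg_cst.
apply: (squeeze_cvgr (f := fun n =>
    Num.max (1 - k n - x * ((1 + k n) * (1 + 2 * k n) / 2)) 0)
  (h := fun n => Num.max (1 + 2 * k n - x * ((1 - k n) / 2)) 0)).
- by apply: filterS _ bounds => n [_ _ -> ->].
- apply: max_cvg.
  rewrite (_ : 1 - x / 2 = 1 - 0 - x * ((1 + 0) * (1 + 2 * 0) / 2)); last first.
    by ring.
  apply: cvgB; first by apply: cvgB => //; exact: cvg_cst.
  apply: cvgMr; apply: cvgMl; apply: cvgM.
    by apply: cvgD => //; exact: cvg_cst.
  by apply: cvgD; [exact: cvg_cst|exact: cvgMr].
apply: max_cvg.
rewrite (_ : 1 - x / 2 = 1 + 2 * 0 - x * ((1 - 0) / 2)); last by ring.
apply: cvgB; first by apply: cvgD; [exact: cvg_cst|exact: cvgMr].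
apply: cvgMr; apply: cvgMl.
by apply: cvgB => //; exact: cvg_cst.
Qed.

Lemma exponential_limit_shape :
  q n @[n --> \oo] --> (0 : R) -> q n ^+ 2 * n%:R @[n --> \oo] --> +oo ->
  recurrent_limit_shape q (fun x : R => expR (- x)).
Proof.
move=> q_to0 y_dvg lam lamR x x0.
pose e n := (q n ^+ 2 * n%:R)^-1; pose d n := 2 * Num.sqrt (e n).
have e_to0 : e n @[n --> \oo] --> (0 : R).
  apply/gtr0_cvgV0 => //; apply: filterS _ (nbhs_infty_gt 0) => n n0.
  by have /andP[q0 _] := q01 n0; rewrite mulr_gt0 ?exprn_gt0 // ltr0n.
have d_to0 : 1 + d n @[n --> \oo] --> (1 : R).
  rewrite [X in _ --> X](_ : 1 = 1 + 2 * Num.sqrt 0 :> R); last first.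
    by rewrite sqrtr0 mulr0 addr0.
  apply: cvgD; first exact: cvg_cst.
  by apply: cvgMr; apply: continuous_cvg e_to0; exact: sqrt_continuous.
have V_cvg (u : nat -> R) : u n @[n --> \oo] --> (1 : R) ->
    x / u n @[n --> \oo] --> x.
  move=> u1; rewrite -[X in _ --> X]divr1; apply: cvgMr.
  by apply: cvgV => //; exact: oner_neq0.
apply: (squeeze_cvgr
  (f := fun n => expR (- (x / (1 - q n))) / (1 + d n) - e n)
  (h := fun n => expR (q n - x / (1 + d n)) * (1 + d n))).
- apply: filterS2 _ (nbhs_infty_gt 0) (cvgr_lt _ q_to0 _ ltr01) => n n0 q1.
  apply: exponential_boundary_bounds => //; last exact: lamR.
  by rewrite q1 andbT; have /andP[] := q01 n0.
- rewrite -[X in _ --> X]subr0 -[X in X - 0]divr1; apply: cvgB => //.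
  apply: cvgM; last by apply: cvgV => //; exact: oner_neq0.
  apply: continuous_cvg; first exact: continuous_expR.
  apply: cvgN; apply: V_cvg; rewrite -[X in _ --> X]subr0.
  by apply: cvgB => //; exact: cvg_cst.
rewrite -[X in _ --> X]mulr1; apply: cvgM => //.
apply: continuous_cvg; first exact: continuous_expR.
by rewrite -[- x]add0r; apply: cvgB => //; exact: V_cvg.
Qed.

End Limits.

Theorem mainTheorem7 (R : realType) (q : nat -> R)
    (q01 : forall n : nat, (0 < n)%N -> 0 < q n <= 1)
    (q_to0 : q n @[n --> \oo] --> (0 : R)) :
  (q n ^+ 2 * n%:R @[n --> \oo] --> (0 : R) ->
     recurrent_limit_shape q (fun x : R => Num.max (1 - x / 2) 0)) /\
  (q n ^+ 2 * n%:R @[n --> \oo] --> +oo ->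
     recurrent_limit_shape q (fun x : R => expR (- x))).
Proof.
split; first exact: triangular_limit_shape.
exact: exponential_limit_shape.
Qed.
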